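(* Let $k\ge2$ and let $G\subseteq H$ be $k$-graphs with $e_G\ge1$, where every copy of $G$ in $H$ is induced. Let $\ell\ge 0$. There is $n_0=n_0(H,\ell)$ such that the following holds for all $n\ge n_0$. Let $X_H$ be the number of copies of $H$ in $G^{(k)}_{n,p}$, and let $Y_G$ be the number of copies of $G$ in $G^{(k)}_{n,p}[\mathcal U]$, where $\mathcal U\subseteq[n]$ satisfies $\bigl||\mathcal U|-n/2\bigr|\le\ell$. For all $p\in[0,1]$ and $\varepsilon\in(0,1]$ satisfying $(\varepsilon\,\mathbb E X_H)^2\ge\Lambda(X_H)$ we have, with $\lambda=2^{v_H+3}$ and $c=2^{-(4^{v_G^2}+2)}$, $$\mathbb P(X_H\le(1-\varepsilon)\mathbb E X_H)\ \ge\ c\;\mathbb P(Y_G\le(1-\lambda\varepsilon)\mathbb E Y_G).$$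
   Context: A $k$-graph is a (finite) $k$-uniform hypergraph; isolated vertices are allowed. $e_H=|E(H)|$ and $v_H=|V(H)|$. $G\subseteq H$ means that $G$ is a (not necessarily induced) subgraph of $H$. A copy of $G$ in a $k$-graph $F$ is a subgraph of $F$ isomorphic to $G$; it is induced if it contains every edge of $F$ all of whose vertices lie in the copy's vertex set. $G^{(k)}_{n,p}$ is the random $k$-graph on $[n]=\{1,\dots,n\}$ in which each of the $\binom nk$ edges of the complete $k$-graph $K_n^{(k)}$ is included independently with probability $p$; $G^{(k)}_{n,p}[\mathcal U]$ is its subgraph induced on the vertex set $\mathcal U$. With $\mathcal H$ the set of all copies of $H$ in $K_n^{(k)}$ and $I_\alpha=\mathbf 1_{\{E(\alpha)\subseteq E(G^{(k)}_{n,p})\}}$ for $\alpha\in\mathcal H$, so that $X_H=\sum_{\alpha\in\mathcal H}I_\alpha$, one defines $\Lambda(X_H)=\mathbb E X_H+\sum_{(\alpha,\beta)}\mathbb E I_\alpha I_\beta$, the sum being over all ordered pairs $(\alpha,\beta)\in\mathcal H\times\mathcal H$ with $\alpha\neq\beta$ and $E(\alpha)\cap E(\beta)\ne\emptyset$. *)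

(* Defs.v *)
From HB Require Import structures.
From mathcomp Require Import all_boot all_order all_algebra.
From mathcomp Require Import reals.

Set Implicit Arguments.
Unset Strict Implicit.
Unset Printing Implicit Defensive.

Import Order.TTheory GRing.Theory Num.Theory.
Local Open Scope ring_scope.

(* A k-graph with vertices in a finite ambient type T is a pair (V, E) with
   V a set of elements of T, not necessarily all of T, and E a set of
   k-subsets of V.  Thus a graph, its subgraphs and the copies of a graph in
   another one are all of type [kgraph k T], and isolated vertices count as
   part of the data (in particular for equality of copies). *)
Definition kgraph_axiom (k : nat) (T : finType)
    (g : {set T} * {set {set T}}) : bool :=
  [forall e in g.2, (e \subset g.1) && (#|e| == k)].

Record kgraph (k : nat) (T : finType) := KGraph {
  kgraph_val :> {set T} * {set {set T}};
  _ : kgraph_axiom k kgraph_val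
}.

HB.instance Definition _ (k : nat) (T : finType) :=
  [isSub for @kgraph_val k T].
HB.instance Definition _ (k : nat) (T : finType) :=
  [Finite of kgraph k T by <:].

Definition vset k (T : finType) (G : kgraph k T) : {set T} :=
  (kgraph_val G).1.
Definition eset k (T : finType) (G : kgraph k T) : {set {set T}} :=
  (kgraph_val G).2.

Definition vnum k (T : finType) (G : kgraph k T) : nat := #|vset G|.
Definition edgenum k (T : finType) (G : kgraph k T) : nat := #|eset G|.

Definition subgraph k (T : finType) (G F : kgraph k T) : bool :=
  (vset G \subset vset F) && (eset G \subset eset F).

(* f is defined on all of T, but only its restriction to [vset G] matters.
   (If T' is empty there may be no f at all; this only affects graphs without
   vertices.) *)
Definition isomorphic k (T T' : finType)
    (G : kgraph k T) (G' : kgraph k T') : bool :=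
  [exists f : {ffun T -> T'},
    [&& dinjectiveb f (vset G),
        f @: vset G == vset G' &
        [set f @: (e : {set T}) | e in eset G] == eset G']].

Definition copies k (T T' : finType) (G : kgraph k T) (F : kgraph k T') :
    {set kgraph k T'} :=
  [set a | subgraph a F && isomorphic G a].

Definition ncopies k (T T' : finType) (G : kgraph k T) (F : kgraph k T') :
    nat := #|copies G F|.

Definition induced_in k (T : finType) (F a : kgraph k T) : bool :=
  [forall e in eset F, (e \subset vset a) ==> (e \in eset a)].

Lemma induce_subproof k (T : finType) (F : kgraph k T) (U : {set T}) :
  kgraph_axiom k (vset F :&: U, [set e in eset F | e \subset U]).
Proof.
apply/forall_inP => e /=; rewrite inE => /andP[eF eU].
have /forall_inP/(_ e eF)/andP[eV ->] := valP F.
by rewrite subsetI eV eU.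
Qed.

Definition induce k (T : finType) (F : kgraph k T) (U : {set T}) :
  kgraph k T := KGraph (induce_subproof F U).

Lemma complete_subproof (k n : nat) :
  kgraph_axiom k ([set: 'I_n], [set e : {set 'I_n} | #|e| == k]).
Proof. by apply/forall_inP => e /=; rewrite inE subsetT. Qed.

Definition complete (k n : nat) : kgraph k 'I_n :=
  KGraph (complete_subproof k n).

(* The sample space of the random k-graph consists of the k-graphs F whose
   vertex set is all of 'I_n, with the product measure over the edges of the
   complete k-graph. *)
Definition gnp_mass (R : realType) (k n : nat) (p : R)
    (F : kgraph k 'I_n) : R :=
  \prod_(e in eset (complete k n)) (if e \in eset F then p else 1 - p).

Definition gnp_pr (R : realType) (k n : nat) (p : R)
    (A : pred (kgraph k 'I_n)) : R :=
  \sum_(F : kgraph k 'I_n | (vset F == [set: 'I_n]) && A F) gnp_mass p F.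

Definition gnp_exp (R : realType) (k n : nat) (p : R)
    (X : kgraph k 'I_n -> R) : R :=
  \sum_(F : kgraph k 'I_n | vset F == [set: 'I_n]) gnp_mass p F * X F.

Definition copy_ind (R : realType) (k n : nat) (a F : kgraph k 'I_n) : R :=
  (eset a \subset eset F)%:R.

Definition X_ (R : realType) (k : nat) (T : finType) (H : kgraph k T)
    (n : nat) (F : kgraph k 'I_n) : R := (ncopies H F)%:R.
Arguments X_ R {k T} H n F.

Definition Y_ (R : realType) (k : nat) (T : finType) (G : kgraph k T)
    (n : nat) (U : {set 'I_n}) (F : kgraph k 'I_n) : R :=
  (ncopies G (induce F U))%:R.
Arguments Y_ R {k T} G {n} U F.

Definition Lambda (R : realType) (k : nat) (T : finType) (H : kgraph k T)
    (n : nat) (p : R) : R :=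
  gnp_exp p (X_ R H n) +
  \sum_(ab : kgraph k 'I_n * kgraph k 'I_n |
        [&& ab.1 \in copies H (complete k n),
            ab.2 \in copies H (complete k n),
            ab.1 != ab.2 & eset ab.1 :&: eset ab.2 != set0])
    gnp_exp p (fun F => copy_ind R ab.1 F * copy_ind R ab.2 F).

(* Main.v *)
Require Import Defs.
From HB Require Import structures.
From mathcomp Require Import all_boot all_order all_algebra.
From mathcomp Require Import perm.
From mathcomp Require Import reals.
From mathcomp Require Import ring lra.

Set Implicit Arguments.
Unset Strict Implicit.
Unset Printing Implicit Defensive.

Import Order.TTheory GRing.Theory Num.Theory.
Local Open Scope ring_scope.

(* Let Z count the copies of H whose restriction to U is a copy of G, and let
   X_H = Z + Z'.  Given the edges inside U, the conditional mean of Z is a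
   constant multiple of Y_G, and E Z >= 2^(-v_H - 1) E X_H for n large; so on
   the decreasing event A := {Y_G <= (1 - lambda eps) E Y_G} this conditional
   mean is at most E Z - 4 eps E X_H.  The conditional variance of X_H is
   bounded by an increasing function L of the edges inside U with
   E L <= Lambda(X_H), and the squared positive part of E(Z' | U) - E Z' is
   increasing with mean at most Var Z' <= Lambda(X_H).  By Harris' inequality
   conditioning on A does not increase the means of these two functions, and
   Chebyshev's inequality under the conditional law gives
   P(X_H <= (1 - eps) E X_H) >= 5/9 P(A). *)

(** * Product measures on the subsets of a finite type *)

Section RandomSubset.
Variables (R : realFieldType) (I : finType) (q : I -> R).
Hypothesis q01 : forall i, 0 <= q i <= 1.
Implicit Types (S D B : {set I}) (f g : {set I} -> R).

Definition rmass S : R := \prod_i (if i \in S then q i else 1 - q i).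
Definition rexp f : R := \sum_(S : {set I}) rmass S * f S.
Definition setmono f := forall S S', S \subset S' -> f S <= f S'.

Lemma rmass_ge0 S : 0 <= rmass S.
Proof.
apply: prodr_ge0 => i _; have /andP[q0 q1] := q01 i.
by case: ifP => // _; rewrite subr_ge0.
Qed.

(** Distributivity over the coordinates: a set [S] that misses a point of [B] picks up a zero
    factor. The case [B = set0] gives total mass 1. *)
Lemma rexp_sub B : rexp (fun S => (B \subset S)%:R) = \prod_(i in B) q i.
Proof.
transitivity (\prod_i (q i + (if i \in B then 0 else 1 - q i))).
  rewrite /rexp bigA_distr /=; apply: eq_bigr => S _.
  have [BS|/subsetPn[i iB iS]] := boolP (B \subset S).
    rewrite mulr1; apply: eq_bigr => i _; case: ifP => // iS.
    by case: ifP => // /(subsetP BS); rewrite iS.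
  by rewrite mulr0 (bigD1 i) //= (negPf iS) iB mul0r.
rewrite [RHS]big_mkcond; apply: eq_bigr => i _; case: ifP => _; first by rewrite addr0.
by rewrite addrC subrK.
Qed.

Lemma sum_rmass : \sum_(S : {set I}) rmass S = 1.
Proof.
have := rexp_sub set0; rewrite big_set0 => <-.
by apply: eq_bigr => S _; rewrite sub0set mulr1.
Qed.

Lemma rexpD f g : rexp (fun S => f S + g S) = rexp f + rexp g.
Proof. by rewrite /rexp -big_split; apply: eq_bigr => S _; rewrite mulrDr. Qed.

Lemma rexpB f g : rexp (fun S => f S - g S) = rexp f - rexp g.
Proof. by rewrite /rexp -sumrB; apply: eq_bigr => S _; rewrite mulrBr. Qed.

Lemma rexpZ c f : rexp (fun S => c * f S) = c * rexp f.
Proof. by rewrite /rexp mulr_sumr; apply: eq_bigr => S _; rewrite mulrCA. Qed.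

Lemma rexpC c : rexp (fun=> c) = c.
Proof. by rewrite /rexp -mulr_suml sum_rmass mul1r. Qed.

Lemma rexp_sum (J : Type) (r : seq J) (P : pred J) (F : J -> {set I} -> R) :
  rexp (fun S => \sum_(j <- r | P j) F j S) = \sum_(j <- r | P j) rexp (F j).
Proof.
by rewrite /rexp exchange_big; apply: eq_bigr => S _; rewrite mulr_sumr.
Qed.

Lemma eq_rexp f g : f =1 g -> rexp f = rexp g.
Proof. by move=> fg; apply: eq_bigr => S _; rewrite fg. Qed.

Lemma ler_rexp f g : (forall S, f S <= g S) -> rexp f <= rexp g.
Proof. by move=> fg; apply: ler_sum => S _; rewrite ler_wpM2l ?rmass_ge0. Qed.

Lemma rexp_ge0 f : (forall S, 0 <= f S) -> 0 <= rexp f.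
Proof. by move=> f0; apply: sumr_ge0 => S _; rewrite mulr_ge0 ?rmass_ge0. Qed.

Lemma rexp_var f :
  rexp (fun S => (f S - rexp f) ^+ 2) = rexp (fun S => f S ^+ 2) - rexp f ^+ 2.
Proof.
set m := rexp f; rewrite (@eq_rexp _ (fun S => f S ^+ 2 - (2 * m * f S - m ^+ 2))).
  by rewrite !rexpB rexpZ rexpC -/m; ring.
by move=> S; ring.
Qed.

Lemma sqr_rexp_le f : rexp f ^+ 2 <= rexp (fun S => f S ^+ 2).
Proof.
by rewrite -subr_ge0 -rexp_var; apply: rexp_ge0 => S; rewrite sqr_ge0.
Qed.

(** * Conditioning by resampling coordinates *)

Definition mix D S S' := (S :&: D) :|: (S' :\: D).

(* The conditional expectation given [S :&: D]: resample outside [D]. *)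
Definition cexp D f S := rexp (fun S' => f (mix D S S')).

Lemma mix_mixl D S S' S'' : mix D (mix D S S') S'' = mix D S S''.
Proof. by apply/setP => i; rewrite !inE; case: (i \in D); rewrite ?andbF ?andbT ?orbF. Qed.

Lemma mixK D S S' : mix D (mix D S S') (mix D S' S) = S.
Proof. by apply/setP => i; rewrite !inE; case: (i \in D); rewrite ?andbF ?andbT ?orbF. Qed.

Lemma sub_mix D B S S' :
  (B \subset mix D S S') = (B :&: D \subset S) && (B :\: D \subset S').
Proof.
apply/subsetP/andP => [sB|[/subsetP s1 /subsetP s2] i iB].
  by split; apply/subsetP => i; rewrite inE => /andP[] h1 h2;
     [have := sB i h1|have := sB i h2]; rewrite !inE ?h1 ?h2 ?(negPf h1) ?andbT ?andbF ?orbF.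
have := s1 i; have := s2 i; rewrite !inE iB.
by case: (i \in D) => /= h2 h1; [rewrite h1|rewrite h2 ?orbT].
Qed.

Lemma mixS D S1 S2 S' : S1 \subset S2 -> mix D S1 S' \subset mix D S2 S'.
Proof. by move=> h; rewrite /mix setUSS // setSI. Qed.

Lemma rmass_mix D S S' : rmass (mix D S S') * rmass (mix D S' S) = rmass S * rmass S'.
Proof.
rewrite /rmass -!big_split; apply: eq_bigr => i _ /=; rewrite !inE.
by case: (i \in D); rewrite ?andbF ?andbT ?orbF //= mulrC.
Qed.

(* Swapping the parts outside [D] of two independent samples preserves their law. *)
Lemma rexp_cexp D f : rexp (cexp D f) = rexp f.
Proof.
pose h (u : {set I} * {set I}) := (mix D u.1 u.2, mix D u.2 u.1).
have hK : involutive h by case=> S S'; rewrite /h /= !mixK.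
transitivity (\sum_(u : {set I} * {set I}) rmass u.1 * rmass u.2 * f (h u).1).
  rewrite /rexp /cexp /rexp -(pair_bigA _ (fun S S' => rmass S * rmass S' * f (h (S, S')).1)) /=.
  by apply: eq_bigr => S _; rewrite mulr_sumr; apply: eq_bigr => S' _; rewrite mulrA.
rewrite (reindex_inj (inv_inj hK)) /=.
transitivity (\sum_(u : {set I} * {set I}) rmass u.1 * rmass u.2 * f u.1).
  by apply: eq_bigr => -[S S'] _ /=; rewrite rmass_mix mixK.
rewrite -(pair_bigA _ (fun S S' => rmass S * rmass S' * f S)) /=; apply: eq_bigr => S _.
by rewrite -mulr_suml -mulr_sumr sum_rmass mulr1.
Qed.

Lemma cexp_mix D f S S' : cexp D f (mix D S S') = cexp D f S.
Proof. by apply: eq_rexp => S''; rewrite mix_mixl. Qed.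

Lemma cexp_mono D f : setmono f -> setmono (cexp D f).
Proof. by move=> fm S1 S2 S12; apply: ler_rexp => S; apply/fm/mixS. Qed.

Lemma cexp_sub D B S :
  cexp D (fun S => (B \subset S)%:R) S = (B :&: D \subset S)%:R * \prod_(i in B :\: D) q i.
Proof.
rewrite -rexp_sub -rexpZ; apply: eq_rexp => S'.
by rewrite sub_mix -natrM mulnb.
Qed.

(** Condition on all coordinates but [i]: the resampled [f] is then an affine function of the
    indicator of [i \in S'], whose mean is [q i]. *)
Lemma rexp_coord i f :
  rexp f = q i * rexp (fun S => f (i |: S)) + (1 - q i) * rexp (fun S => f (S :\ i)).
Proof.
have Pi : rexp (fun S => (i \in S)%:R) = q i.
  have := rexp_sub [set i]; rewrite big_set1 => <-.
  by apply: eq_rexp => S; rewrite sub1set.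
rewrite -(rexp_cexp [set~ i]) -2!rexpZ -rexpD; apply: eq_rexp => S.
rewrite /cexp -Pi.
transitivity (rexp (fun S' => f (S :\ i) + (f (i |: S) - f (S :\ i)) * (i \in S')%:R)).
  apply: eq_rexp => S'.
  have -> : mix [set~ i] S S' = if i \in S' then i |: S else S :\ i.
    apply/setP => j; rewrite !inE; have [->|ji] := eqVneq j i.
      by rewrite andbF /=; case: ifP => iS'; rewrite !inE eqxx.
    by rewrite andbT orbF; case: ifP => iS'; rewrite !inE (negPf ji) /= ?andbT.
  by case: ifP => _; rewrite ?mulr1 ?mulr0 ?addr0 // addrC subrK.
by rewrite rexpD rexpC rexpZ; ring.
Qed.

(* Harris' inequality, by induction on the set of coordinates [f] and [g] depend on. *)
Lemma harris f g : setmono f -> setmono g ->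
  rexp f * rexp g <= rexp (fun S => f S * g S).
Proof.
suff gen D : forall f g, setmono f -> setmono g ->
    (forall S, f S = f (S :&: D)) -> (forall S, g S = g (S :&: D)) ->
    rexp f * rexp g <= rexp (fun S => f S * g S).
  by move=> fm gm; apply: (gen setT) => // S; rewrite setIT.
elim: {D}#|D| {-2}D (erefl #|D|) => [|n IHn] D cD {}f {}g fm gm fD gD.
  have D0 : D = set0 by apply/eqP; rewrite -cards_eq0 cD.
  rewrite (@eq_rexp f (fun=> f set0)); last by move=> S; rewrite fD D0 setI0.
  rewrite (@eq_rexp g (fun=> g set0)); last by move=> S; rewrite gD D0 setI0.
  rewrite (@eq_rexp (fun S => f S * g S) (fun=> f set0 * g set0)) ?rexpC //.
  by move=> S; rewrite fD gD D0 setI0.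
have [i iD] : exists i, i \in D by apply/set0Pn; rewrite -cards_eq0 cD.
have cD' : #|D :\ i| = n by move: cD; rewrite (cardsD1 i) iD => -[].
have H1 (h : {set I} -> R) : (forall S, h S = h (S :&: D)) ->
    forall S, h (i |: S) = h (i |: (S :&: (D :\ i))).
  move=> hD S; rewrite hD [RHS]hD; congr h; apply/setP => j; rewrite !inE.
  by have [->|] := eqVneq j i; rewrite ?andbT //= -andbA andbb.
have H0 (h : {set I} -> R) : (forall S, h S = h (S :&: D)) ->
    forall S, h (S :\ i) = h ((S :&: (D :\ i)) :\ i).
  move=> hD S; rewrite hD [RHS]hD; congr h; apply/setP => j; rewrite !inE.
  by have [->|] := eqVneq j i; rewrite ?andbT //= -andbA andbb.
have M1 (h : {set I} -> R) : setmono h -> setmono (fun S => h (i |: S)).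
  by move=> hm S S' SS'; apply/hm/setUS.
have M0 (h : {set I} -> R) : setmono h -> setmono (fun S => h (S :\ i)).
  by move=> hm S S' SS'; apply/hm/setSD.
have M01 (h : {set I} -> R) : setmono h -> rexp (fun S => h (S :\ i)) <= rexp (fun S => h (i |: S)).
  by move=> hm; apply: ler_rexp => S; apply: hm; rewrite subDset subsetU // subsetUr orbT.
have h1 := IHn _ cD' _ _ (M1 _ fm) (M1 _ gm) (H1 _ fD) (H1 _ gD).
have h0 := IHn _ cD' _ _ (M0 _ fm) (M0 _ gm) (H0 _ fD) (H0 _ gD).
rewrite (rexp_coord i f) (rexp_coord i g) (rexp_coord i (fun S => f S * g S)).
move: (M01 _ fm) (M01 _ gm) (q01 i) h1 h0 => /=.
set f0 := rexp (fun S => f (S :\ i)); set f1 := rexp (fun S => f (i |: S)).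
set g0 := rexp (fun S => g (S :\ i)); set g1 := rexp (fun S => g (i |: S)).
set e0 := rexp (fun S => f (S :\ i) * _); set e1 := rexp (fun S => f (i |: S) * _).
move: (q i) f0 f1 g0 g1 e0 e1 => t f0 f1 g0 g1 e0 e1 a b /andP[t0 t1] h1 h0.
have := ler_wpM2l t0 h1; have t1' : 0 <= 1 - t by rewrite subr_ge0.
have := ler_wpM2l t1' h0.
(* The covariance of two increasing two-point variables, with values [f0], [f1] and [g0], [g1] taken
   with weights [1 - t] and [t]. *)
have : 0 <= t * (1 - t) * ((f1 - f0) * (g1 - g0)).
  by rewrite mulr_ge0 // mulr_ge0 // subr_ge0.
by lra.
Qed.

(* Pairs with disjoint [B j] are uncorrelated. *)
Lemma var_sum_le (J : finType) (P : {set J}) (c : J -> R) (B : J -> {set I}) f :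
  (forall j, 0 <= c j) ->
  (forall S, f S = \sum_(j in P) c j * (B j \subset S)%:R) ->
  rexp (fun S => f S ^+ 2) - rexp f ^+ 2 <=
  \sum_(u : J * J | [&& u.1 \in P, u.2 \in P & B u.1 :&: B u.2 != set0])
    rexp (fun S => (c u.1 * (B u.1 \subset S)%:R) * (c u.2 * (B u.2 \subset S)%:R)).
Proof.
move=> c0 fE; pose x j S := c j * (B j \subset S)%:R.
have x0 j S : 0 <= x j S by rewrite mulr_ge0 ?ler0n.
have -> : rexp (fun S => f S ^+ 2) =
    \sum_(u | (u.1 \in P) && (u.2 \in P)) rexp (fun S => x u.1 S * x u.2 S).
  rewrite -rexp_sum; apply: eq_rexp => S.
  by rewrite fE expr2 big_distrlr pair_big /=.
have -> : rexp f ^+ 2 = \sum_(u | (u.1 \in P) && (u.2 \in P)) rexp (x u.1) * rexp (x u.2).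
  by rewrite expr2 (eq_rexp fE) rexp_sum big_distrlr pair_big.
rewrite -sumrB (bigID (fun u => B u.1 :&: B u.2 != set0)) /=.
rewrite [X in _ + X]big1 ?addr0 => [|u /andP[_ /negPn/eqP dB]].
  (* For pairs whose sets meet, only the product of the means is discarded; it is nonnegative
     because [c] is. *)
  rewrite (eq_bigl _ _ (fun u => esym (andbA _ _ _))); apply: ler_sum => u _.
  by rewrite gerBl mulr_ge0 // rexp_ge0.
have xE j : rexp (x j) = c j * \prod_(i in B j) q i by rewrite rexpZ rexp_sub.
apply/eqP; rewrite subr_eq0 !xE mulrACA; apply/eqP.
rewrite (@eq_rexp _ (fun S => c u.1 * c u.2 * (B u.1 :|: B u.2 \subset S)%:R)); last first.
  by move=> S; rewrite /x mulrACA -natrM mulnb subUset.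
rewrite rexpZ rexp_sub; congr (_ * _); rewrite -bigU; last by rewrite -setI_eq0 dB.
by apply: eq_bigl => i; rewrite !inE.
Qed.

(** The probabilistic core, with [d] in the role of [eps * mu]. On [a] the conditional mean of [X Z]
    is too low by [4 * d]; to leave the lower tail, random deviations must make up [3 * d]. Given
    [a], their second moment is at most [2 * (d ^+ 2 + d ^+ 2)], so by Chebyshev this has
    conditional probability at most 4/9. *)
Lemma lower_tail_bootstrap (J : finType) (P Z : {set J}) (A : J -> {set I})
    (D : {set I}) (a : pred {set I}) (d : R) :
  let X (Q : {set J}) S : R := \sum_(j in Q) (A j \subset S)%:R in
  Z \subset P -> 0 < d ->
  (forall S S', S \subset S' -> a S' -> a S) ->
  (forall S S', a (mix D S S') = a S) ->
  (forall S, a S -> cexp D (X Z) S <= rexp (X Z) - 4 * d) ->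
  \sum_(u : J * J | [&& u.1 \in P, u.2 \in P & A u.1 :&: A u.2 != set0])
    rexp (fun S => (A u.1 \subset S)%:R * (A u.2 \subset S)%:R) <= d ^+ 2 ->
  5 / 9 * rexp (fun S => (a S)%:R) <= rexp (fun S => (X P S <= rexp (X P) - d)%R%:R).
Proof.
move=> X ZP d0 adec aD aZ Lam.
pose N := P :\: Z.
have XPE S : X P S = X Z S + X N S.
  by rewrite /X (big_setID Z) /= (setIidPr ZP).
have Xmono Q : setmono (X Q).
  move=> S S' SS'; apply: ler_sum => j _; rewrite ler_nat.
  by case: (boolP (A j \subset S)) => // h; rewrite (subset_trans h).
(* An increasing majorant: the conditional expectation of [W] will dominate the conditional variance
   of [X P]. *)
pose W S : R := \sum_(u : J * J | [&& u.1 \in P, u.2 \in P & A u.1 :&: A u.2 != set0])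
    (A u.1 \subset S)%:R * (A u.2 \subset S)%:R.
have Wmono : setmono W.
  move=> S S' SS'; apply: ler_sum => u _; rewrite -!natrM !mulnb ler_nat.
  case: (boolP (A u.1 \subset S)) => // h; rewrite (subset_trans h) //.
  by case: (boolP (A u.2 \subset S)) => // h'; rewrite (subset_trans h').
have EW : rexp W <= d ^+ 2 by rewrite /W rexp_sum.
(* Once [S :&: D] is fixed, the indicator of [A j] becomes a constant [c j] times that of
   [A j :\: D], so [var_sum_le] applies; sets that meet outside [D] are among those that meet. *)
have condvar S : rexp (fun S' => (X P (mix D S S') - cexp D (X P) S) ^+ 2) <= cexp D W S.
  rewrite rexp_var.
  pose c j : R := (A j :&: D \subset S)%:R.
  have cE j S' : (A j \subset mix D S S')%:R = c j * (A j :\: D \subset S')%:R.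
    by rewrite sub_mix -natrM mulnb.
  have XE : (fun S' => X P (mix D S S')) =1 fun S' => \sum_(j in P) c j * (A j :\: D \subset S')%:R.
    by move=> S'; apply: eq_bigr => j _; rewrite cE.
  apply: le_trans (var_sum_le _ XE) _; first by move=> j; rewrite ler0n.
  rewrite /cexp /W rexp_sum [X in X <= _]big_mkcond [X in _ <= X]big_mkcond.
  apply: ler_sum => u _ /=.
  rewrite (@eq_rexp (fun S' => _ * _) (fun S' =>
    (A u.1 \subset mix D S S')%:R * (A u.2 \subset mix D S S')%:R)); last first.
    by move=> S'; rewrite !cE.
  have e0 : 0 <= rexp (fun S' => (A u.1 \subset mix D S S')%:R * (A u.2 \subset mix D S S')%:R).
    by apply: rexp_ge0 => S'; rewrite -natrM ler0n.
  case: (u.1 \in P) => //=; case: (u.2 \in P) => //=.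
  case: (boolP ((A u.1 :\: D) :&: (A u.2 :\: D) != set0)) => [/set0Pn[i]|_]; last by case: ifP.
  rewrite !inE => /andP[/andP[_ i1] /andP[_ i2]].
  by rewrite ifT //; apply/set0Pn; exists i; rewrite inE i1.
pose m' := rexp (X N).
(* The positive part is taken before squaring: the square of the centred conditional mean is not
   monotone in general, and Harris' inequality needs an increasing function. *)
pose h S := Num.max 0 (cexp D (X N) S - m') ^+ 2.
have hmono : setmono h.
  move=> S S' SS'; rewrite /h.
  have := cexp_mono D (Xmono N) SS'; rewrite -(lerD2r (- m')).
  move: (_ - m') (_ - m') => x y xy.
  have p0 (z : R) : 0 <= Num.max 0 z by rewrite le_max lexx.
  by rewrite ler_sqr ?nnegrE ?p0 // ge_max p0 le_max xy orbT.
(* A conditional mean has no larger variance than the variable itself (Jensen), and the meeting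
   pairs within [N] are among those within [P]. *)
have Eh : rexp h <= d ^+ 2.
  apply: le_trans Lam.
  apply: (@le_trans _ _ (rexp (fun S => (cexp D (X N) S - rexp (cexp D (X N))) ^+ 2))).
    apply: ler_rexp => S; rewrite rexp_cexp /h /m' maxEle.
    by case: ifP => _ //; rewrite expr0n sqr_ge0.
  rewrite rexp_var rexp_cexp.
  apply: (@le_trans _ _ (rexp (fun S => X N S ^+ 2) - rexp (X N) ^+ 2)).
    rewrite lerD2r -(rexp_cexp D (fun S => X N S ^+ 2)).
    by apply: ler_rexp => S; apply: sqr_rexp_le.
  have XE : X N =1 fun S => \sum_(j in N) 1 * (A j \subset S)%:R.
    by move=> S; apply: eq_bigr => j _; rewrite mul1r.
  apply: le_trans (var_sum_le _ XE) _ => //.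
  rewrite [X in X <= _]big_mkcond [X in _ <= X]big_mkcond.
  apply: ler_sum => u _ /=.
  rewrite (@eq_rexp (fun S' => _ * _)
    (fun S => (A u.1 \subset S)%:R * (A u.2 \subset S)%:R)); last first.
    by move=> S'; rewrite !mul1r.
  have e0 : 0 <= rexp (fun S => (A u.1 \subset S)%:R * (A u.2 \subset S)%:R).
    by apply: rexp_ge0 => S'; rewrite -natrM ler0n.
  rewrite !inE; case: (u.1 \in P); case: (u.2 \in P); rewrite ?andbF //= ?andbT.
  by case: (A u.1 :&: _ != _); case: (u.1 \in Z); case: (u.2 \in Z).
(* [X - E X] exceeds [-d] on [a] only if [(X - E(X|D)) + (E(Z'|D) - E Z')] exceeds [3 d]. *)
pose b S : R := (rexp (X P) - d < X P S)%R%:R.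
have pt S : (a S)%:R * b S * (9 * d ^+ 2) <=
    2 * ((a S)%:R * (X P S - cexp D (X P) S) ^+ 2 + (a S)%:R * h S).
  case: (boolP (a S)) => [aS|_]; rewrite ?mul0r ?addr0 ?mulr0 // !mul1r /b.
  case: ltP => [XS|_]; last first.
    by rewrite mul0r mulr_ge0 // addr_ge0 ?sqr_ge0.
  rewrite mul1r /h.
  have := aZ S aS.
  have -> : cexp D (X P) S = cexp D (X Z) S + cexp D (X N) S.
    by rewrite /cexp -rexpD; apply: eq_rexp => S'; rewrite XPE.
  move: XS; rewrite (eq_rexp XPE) rexpD -/m'.
  move: (rexp (X Z)) (cexp D (X Z) S) (cexp D (X N) S) (X P S) => ez cz cn x h1 h2.
  set y := Num.max 0 (cn - m').
  have y1 : cn - m' <= y by rewrite le_max lexx orbT.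
  have y0 : 0 <= y by rewrite le_max lexx.
  set z := x - (cz + cn).
  (* The gap [4 * d] given by [a], less the [d] allowed by the tail event, must be covered by [z],
     the deviation from the conditional mean, and by [y], which bounds the excess of the conditional
     mean of [X N]. *)
  have h3 : 3 * d <= z + y by rewrite /z; lra.
  apply: (@le_trans _ _ ((z + y) ^+ 2)).
    have -> : 9 * d ^+ 2 = (3 * d) ^+ 2 by ring.
    by rewrite ler_sqr ?nnegrE; lra.
  rewrite -subr_ge0; have -> : 2 * (z ^+ 2 + y ^+ 2) - (z + y) ^+ 2 = (z - y) ^+ 2 by ring.
  exact: sqr_ge0.
(* Since [a] is determined by [S :&: D], it is a constant under the conditional expectation. *)
have e1 : rexp (fun S => (a S)%:R * (X P S - cexp D (X P) S) ^+ 2) <=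
          rexp (fun S => (a S)%:R * cexp D W S).
  rewrite -(rexp_cexp D); apply: ler_rexp => S.
  rewrite /cexp (@eq_rexp _ (fun S' => (a S)%:R * (X P (mix D S S') - cexp D (X P) S) ^+ 2)).
    by rewrite rexpZ ler_wpM2l ?ler0n // condvar.
  by move=> S'; rewrite aD -!/(cexp _ _ _) cexp_mix.
(* Harris' inequality is applied to [g] and the increasing function [1 - a]. *)
have neg g : setmono g -> rexp (fun S => (a S)%:R * g S) <= rexp (fun S => (a S)%:R) * rexp g.
  move=> gm; have am : setmono (fun S => 1 - (a S)%:R).
    move=> S S' SS'; rewrite lerD2l lerN2 ler_nat.
    by case: (boolP (a S')) => // /(adec _ _ SS') ->.
  have := harris am gm.
  rewrite rexpB rexpC (@eq_rexp (fun S => _ * g S) (fun S => g S - (a S)%:R * g S)).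
    by rewrite rexpB; lra.
  by move=> S; ring.
have e2 : rexp (fun S => (a S)%:R * b S) * (9 * d ^+ 2) <= 4 * d ^+ 2 * rexp (fun S => (a S)%:R).
  rewrite [X in X <= _]mulrC -[X in X <= _]rexpZ.
  apply: (@le_trans _ _ (2 * (rexp (fun S => (a S)%:R) * rexp (cexp D W) +
                             rexp (fun S => (a S)%:R) * rexp h))).
    apply: (@le_trans _ _ (2 * (rexp (fun S => (a S)%:R * (X P S - cexp D (X P) S) ^+ 2) +
                               rexp (fun S => (a S)%:R * h S)))).
      by rewrite -rexpD -rexpZ; apply: ler_rexp => S; rewrite mulrC pt.
    rewrite ler_wpM2l // lerD ?neg //.
    by apply: le_trans e1 _; apply/neg/cexp_mono.
  have a0 : 0 <= rexp (fun S => (a S)%:R) by apply: rexp_ge0 => S; rewrite ler0n.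
  rewrite rexp_cexp; have := ler_wpM2l a0 EW; have := ler_wpM2l a0 Eh; lra.
have e3 : rexp (fun S => (a S)%:R * b S) <= 4 / 9 * rexp (fun S => (a S)%:R).
  have d2 : 0 < 9 * d ^+ 2 by rewrite mulr_gt0 // exprn_gt0.
  by rewrite -(ler_pM2r d2); lra.
(* The difference is the indicator of [a] together with the lower tail, whence the factor
   [1 - 4 / 9]. *)
apply: (@le_trans _ _ (rexp (fun S => (a S)%:R - (a S)%:R * b S))).
  by rewrite rexpB; lra.
apply: ler_rexp => S; rewrite /b ltNge.
by case: (a S); case: (X P S <= _); rewrite /= ?mul1r ?mul0r ?subrr ?subr0.
Qed.

End RandomSubset.

(** * Images of graphs *)

Lemma kgraph_inj k (T : finType) (G G' : kgraph k T) :
  vset G = vset G' -> eset G = eset G' -> G = G'.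
Proof.
case: G G' => [[V E] h] [[V' E'] h']; rewrite /vset /eset /= => eV eE.
by apply/val_inj; rewrite /= eV eE.
Qed.

Lemma edge_sub k (T : finType) (G : kgraph k T) e : e \in eset G -> e \subset vset G.
Proof. by move=> eG; have /forall_inP/(_ e eG)/andP[] := valP G. Qed.

Lemma card_edge k (T : finType) (G : kgraph k T) e : e \in eset G -> #|e| = k.
Proof. by move=> eG; have /forall_inP/(_ e eG)/andP[_ /eqP] := valP G. Qed.

Lemma gimage_subproof k (T T' : finType) (G : kgraph k T) (f : T -> T') :
  {in vset G &, injective f} ->
  kgraph_axiom k (f @: vset G, [set f @: (e : {set T}) | e in eset G]).
Proof.
move=> fi; apply/forall_inP => _ /= /imsetP[e eG ->].
have eV := edge_sub eG; rewrite imsetS //= card_in_imset ?(card_edge eG) //.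
by move=> x y xe ye; apply: fi; apply: (subsetP eV).
Qed.

Definition gimage k (T T' : finType) (G : kgraph k T) (f : T -> T')
  (fi : {in vset G &, injective f}) : kgraph k T' := KGraph (gimage_subproof fi).

Lemma isomorphicP k (T T' : finType) (G : kgraph k T) (G' : kgraph k T') :
  reflect (exists (f : {ffun T -> T'}) (fi : {in vset G &, injective f}), gimage fi = G')
          (isomorphic G G').
Proof.
apply: (iffP existsP) => [[f /and3P[/dinjectiveP fi /eqP eV /eqP eE]]|[f [fi <-]]].
  by exists f, fi; apply: kgraph_inj.
by exists f; rewrite !eqxx /= andbT; apply/dinjectiveP.
Qed.

Lemma isomorphic_refl k (T : finType) (G : kgraph k T) : isomorphic G G.
Proof.
apply/isomorphicP; exists [ffun x => x].
have fi : {in vset G &, injective [ffun x : T => x]} by move=> x y _ _; rewrite !ffunE.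
exists fi; apply: kgraph_inj; rewrite /vset /eset /=.
  by rewrite (eq_imset _ (ffunE _)) imset_id.
rewrite -[RHS]imset_id; apply: eq_imset => e /=.
by rewrite (eq_imset _ (ffunE _)) imset_id.
Qed.

Lemma edgenum_iso k (T T' : finType) (G : kgraph k T) (G' : kgraph k T') :
  isomorphic G G' -> edgenum G' = edgenum G.
Proof.
case/isomorphicP => f [fi <-]; rewrite /edgenum card_in_imset // => e e' eG eG' ee'.
apply/setP => x; apply/idP/idP => xe.
  have : f x \in f @: e' by rewrite -ee' imset_f.
  by case/imsetP => y ye /fi -> //; [apply: (subsetP (edge_sub eG))|apply: (subsetP (edge_sub eG'))].
have : f x \in f @: e by rewrite ee' imset_f.
by case/imsetP => y ye /fi -> //; [apply: (subsetP (edge_sub eG'))|apply: (subsetP (edge_sub eG))].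
Qed.

(** * Vertex permutations acting on graphs *)

Definition gperm k (T : finType) (s : {perm T}) (G : kgraph k T) : kgraph k T :=
  gimage (in2W (@perm_inj _ s) : {in vset G &, injective s}).

Lemma gperm_inj k (T : finType) (s : {perm T}) : injective (@gperm k T s).
Proof.
move=> G G' e; apply: kgraph_inj.
  exact: (imset_inj (@perm_inj _ s) (congr1 (@vset _ _) e)).
exact: (imset_inj (imset_inj (@perm_inj _ s)) (congr1 (@eset _ _) e)).
Qed.

Lemma gperm_gimage k (T T' : finType) (G : kgraph k T) (f g : {ffun T -> T'})
    (fi : {in vset G &, injective f}) (gi : {in vset G &, injective g}) (s : {perm T'}) :
  {in vset G, forall x, s (f x) = g x} -> gperm s (gimage fi) = gimage gi.
Proof.
move=> sfg; apply: kgraph_inj; rewrite /vset /eset /= -imset_comp; apply: eq_in_imset.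
  by move=> x xG; apply: sfg.
move=> e eG /=; rewrite -imset_comp; apply: eq_in_imset => x xe.
exact/sfg/(subsetP (edge_sub eG)).
Qed.

Lemma isomorphic_gperm k (T T' : finType) (G : kgraph k T) (G' : kgraph k T') (s : {perm T'}) :
  isomorphic G G' -> isomorphic G (gperm s G').
Proof.
case/isomorphicP => f [fi <-]; apply/isomorphicP; exists [ffun x => s (f x)].
have si : {in vset G &, injective [ffun x => s (f x)]}.
  by move=> x y xG yG; rewrite !ffunE => /perm_inj; apply: fi.
by exists si; apply/esym/gperm_gimage => x _; rewrite ffunE.
Qed.

Lemma induce_gperm k (T : finType) (s : {perm T}) (U : {set T}) (G : kgraph k T) :
  perm_on U s -> induce (gperm s G) U = gperm s (induce G U).
Proof.
move=> pU; have sU := im_perm_on pU; apply: kgraph_inj; rewrite /vset /eset /=.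
  by rewrite imsetI ?sU // => x y _ _; apply: perm_inj.
apply/setP => e; rewrite !inE; apply/andP/imsetP => [[/imsetP[e' e'G ->] e'U]|[e']].
  exists e' => //; rewrite inE e'G /=; apply/subsetP => x xe.
  by rewrite -(perm_closed _ pU) (subsetP e'U) ?imset_f.
by rewrite inE => /andP[e'G e'U] ->; rewrite imset_f //= -sU imsetS.
Qed.

(** A permutation [u] for the tails is followed by the transposition of [u x] and [y]; the absence
    of repetitions keeps the values already placed undisturbed. *)
Lemma perm_extend (T : finType) (U : {set T}) (s t : seq T) :
  size s = size t -> uniq s -> uniq t -> {subset s <= U} -> {subset t <= U} ->
  exists2 u : {perm T}, perm_on U u & map u s = t.
Proof.
elim: s t => [|x s IHs] [|y t] //=; first by exists 1%g; rewrite ?perm_on1.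
move=> [st] /andP[xs us] /andP[yt ut] sU tU.
have [||u uU ust] := IHs t st us ut.
- by move=> z zs; apply: sU; rewrite inE zs orbT.
- by move=> z zt; apply: tU; rewrite inE zt orbT.
have ux : u x \in U by rewrite perm_closed // sU ?mem_head.
exists (u * tperm (u x) y)%g.
  apply: perm_onM => //; apply/subsetP => z; rewrite inE /=.
  by case: tpermP => [->|->|]; rewrite ?eqxx // ?tU ?mem_head.
rewrite permM tpermL -ust; congr (_ :: _); apply/eq_in_map => z zs.
rewrite permM tpermD //.
  by apply: contraNneq xs => /perm_inj ->.
by apply: contraNneq yt => ->; rewrite -ust map_f.
Qed.

(** The vertices of [G], listed in a fixed order, have as images two duplicate-free lists in [U],
    and [perm_extend] carries one to the other. *)
Lemma gperm_trans k (T T' : finType) (G : kgraph k T) (U : {set T'}) (A B : kgraph k T') :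
  isomorphic G A -> isomorphic G B -> vset A \subset U -> vset B \subset U ->
  exists2 s : {perm T'}, perm_on U s & gperm s A = B.
Proof.
case/isomorphicP => f [fi <-] /isomorphicP[g [gi <-]] fU gU.
have sub (h : T -> T') : h @: vset G \subset U -> {subset map h (enum (vset G)) <= U}.
  by move=> /subsetP hU z /mapP[x]; rewrite mem_enum => xG ->; apply/hU/imset_f.
have un (h : T -> T') : {in vset G &, injective h} -> uniq (map h (enum (vset G))).
  by move=> hi; rewrite map_inj_in_uniq ?enum_uniq // => x y; rewrite !mem_enum; apply: hi.
have [|s sU sfg] := perm_extend _ (un _ fi) (un _ gi) (sub _ fU) (sub _ gU).
  by rewrite !size_map.
exists s => //; apply: gperm_gimage => x xG.
move: sfg; rewrite -map_comp => /eq_in_map/(_ x) /=; apply; rewrite mem_enum //.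
Qed.

(** * The random graph as a random subset *)

Lemma edge_graph_subproof (k n : nat) (S : {set {set 'I_n}}) :
  kgraph_axiom k ([set: 'I_n], [set e in S | #|e| == k]).
Proof. by apply/forall_inP => e /=; rewrite inE subsetT => /andP[]. Qed.

Definition edge_graph k n (S : {set {set 'I_n}}) : kgraph k 'I_n :=
  KGraph (edge_graph_subproof k S).

(* Sets that are not of size [k] get probability 0, so that the random edge set
   can range over all sets of sets of vertices. *)
Definition edge_prob (R : realType) (k n : nat) (p : R) (e : {set 'I_n}) : R :=
  if #|e| == k then p else 0.

Lemma edge_prob01 (R : realType) (k n : nat) (p : R) (e : {set 'I_n}) :
  0 <= p <= 1 -> 0 <= edge_prob k p e <= 1.
Proof. by rewrite /edge_prob; case: ifP => // _ _; rewrite lexx ler01. Qed.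

(** Graphs on the full vertex set correspond to the sets [S] of [k]-sets; every other [S] contains a
    set of the wrong size and has mass 0. *)
Lemma gnp_expE (R : realType) (k n : nat) (p : R) (X : kgraph k 'I_n -> R) :
  gnp_exp p X = rexp (@edge_prob R k n p) (fun S => X (edge_graph k S)).
Proof.
rewrite /gnp_exp (reindex_onto (@edge_graph k n) (@eset k _)) /=; last first.
  move=> F /eqP FT; apply: kgraph_inj; rewrite /vset /eset /=.
    by rewrite -/(vset F) FT.
  apply/setP => e; rewrite inE; apply/andP/idP => [[]//|eF].
  by split=> //; apply/eqP; apply: card_edge eF.
rewrite big_mkcond; apply: eq_bigr => S _; rewrite eqxx /=.
have [SE|SE] := eqVneq (eset (edge_graph k S)) S.
  congr (_ * _); rewrite /gnp_mass /rmass big_mkcond; apply: eq_bigr => e _.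
  rewrite SE !inE /edge_prob; case: ifP => // ek.
  have : e \notin eset (edge_graph k S) by rewrite inE ek andbF.
  by rewrite SE => /negPf ->; rewrite subr0.
have [e eS ek] : exists2 e, e \in S & #|e| != k.
  apply/exists_inP; apply: contraR SE => /exists_inPn h.
  apply/eqP/setP => e; rewrite inE andb_idr // => /h; by rewrite negbK.
by rewrite /rmass (bigD1 e) //= eS /edge_prob (negPf ek) !mul0r.
Qed.

Lemma gnp_prE (R : realType) (k n : nat) (p : R) (A : pred (kgraph k 'I_n)) :
  gnp_pr p A = rexp (@edge_prob R k n p) (fun S => (A (edge_graph k S))%:R).
Proof.
rewrite -(gnp_expE p (fun F => (A F)%:R)) /gnp_pr /gnp_exp big_mkcondr.
by apply: eq_bigr => F _; case: (A F); rewrite ?mulr1 ?mulr0.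
Qed.

Lemma sub_eset_edge_graph k n (a : kgraph k 'I_n) S :
  (eset a \subset eset (edge_graph k S)) = (eset a \subset S).
Proof.
apply/subsetP/subsetP => h e ea; first by have := h e ea; rewrite inE => /andP[].
by rewrite inE h //=; apply/eqP; apply: card_edge ea.
Qed.

Lemma sub_eset_complete k n (a : kgraph k 'I_n) : eset a \subset eset (complete k n).
Proof. by apply/subsetP => e ea; rewrite inE; apply/eqP; apply: card_edge ea. Qed.

Lemma mem_copies_complete k (T : finType) (H : kgraph k T) n (a : kgraph k 'I_n) :
  (a \in copies H (complete k n)) = isomorphic H a.
Proof. by rewrite inE /subgraph sub_eset_complete subsetT. Qed.

Lemma mem_copies_induce_complete k (T : finType) (G : kgraph k T) n (U : {set 'I_n})
    (a : kgraph k 'I_n) :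
  (a \in copies G (induce (complete k n) U)) = (vset a \subset U) && isomorphic G a.
Proof.
rewrite inE /subgraph; congr (_ && _).
have -> : vset (induce (complete k n) U) = U by rewrite /vset /= setTI.
apply/andb_idr => aU; apply/subsetP => e ea; rewrite inE.
by rewrite (subsetP (sub_eset_complete a)) //= (subset_trans (edge_sub ea)).
Qed.

Lemma X_edge_graph (R : realType) k (T : finType) (H : kgraph k T) n S :
  X_ R H n (edge_graph k S) =
  \sum_(a in copies H (complete k n)) (eset a \subset S)%:R.
Proof.
rewrite /X_ /ncopies -sum1_card natr_sum big_mkcond [RHS]big_mkcond.
apply: eq_bigr => a _; rewrite mem_copies_complete inE /subgraph subsetT.
by rewrite sub_eset_edge_graph /=; case: (eset a \subset S); case: ifP.
Qed.

Lemma Y_edge_graph (R : realType) k (T : finType) (G : kgraph k T) n (U : {set 'I_n}) S :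
  Y_ R G U (edge_graph k S) =
  \sum_(a in copies G (induce (complete k n) U)) (eset a \subset S)%:R.
Proof.
rewrite /Y_ /ncopies -sum1_card natr_sum big_mkcond [RHS]big_mkcond.
apply: eq_bigr => a _; rewrite mem_copies_induce_complete inE /subgraph.
have -> : vset (induce (edge_graph k S) U) = U by rewrite /vset /= setTI.
case: (boolP (vset a \subset U)) => //= aU.
have -> : (eset a \subset eset (induce (edge_graph k S) U)) = (eset a \subset S).
  rewrite -[RHS]sub_eset_edge_graph; apply/subsetP/subsetP => h e ea.
    by have /setIdP[] := h e ea.
  by apply/setIdP; rewrite h //= (subset_trans (edge_sub ea)).
by case: (eset a \subset S); case: ifP.
Qed.

(** * Counting copies *)

Section Fibers.
Variables (k n : nat) (T : finType) (G H : kgraph k T) (U : {set 'I_n}).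

Definition ext_copies : {set kgraph k 'I_n} :=
  [set a in copies H (complete k n) | isomorphic G (induce a U)].

(** A permutation supported on [U] that takes [g] to [g'] maps the fibre over [g] injectively into
    the fibre over [g']. The common size [N] is what makes the conditional mean of the extending
    copies proportional to [Y_G]. *)
Lemma ext_fiber_const : exists N : nat,
  forall g, g \in copies G (induce (complete k n) U) ->
    #|[set a in copies H (complete k n) | induce a U == g]| = N.
Proof.
have le g g' : g \in copies G (induce (complete k n) U) ->
    g' \in copies G (induce (complete k n) U) ->
    (#|[set a in copies H (complete k n) | induce a U == g]| <=
     #|[set a in copies H (complete k n) | induce a U == g']|)%N.
  rewrite !mem_copies_induce_complete => /andP[gU gG] /andP[gU' gG'].
  have [s sU <-] := gperm_trans gG gG' gU gU'.
  rewrite -(card_imset _ (@gperm_inj k _ s)) subset_leq_card //.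
  apply/subsetP => _ /imsetP[a + ->]; rewrite !inE -!/(_ \in copies _ _).
  move=> /andP[/andP[_ aH] /eqP <-]; rewrite induce_gperm // eqxx andbT.
  by rewrite isomorphic_gperm // andbT /subgraph sub_eset_complete subsetT.
(* Without a copy of [G] inside [U] there is no fibre, and 0 is a placeholder. *)
have [->|[g0 g0G]] := set_0Vmem (copies G (induce (complete k n) U)).
  by exists 0%N => g; rewrite inE.
exists #|[set a in copies H (complete k n) | induce a U == g0]| => g gG.
by apply/eqP; rewrite eqn_leq !le.
Qed.

Lemma sum_ext_copies (R : pzRingType) (F : kgraph k 'I_n -> R) N :
  (forall g, g \in copies G (induce (complete k n) U) ->
    #|[set a in copies H (complete k n) | induce a U == g]| = N) ->
  \sum_(a in ext_copies) F (induce a U) =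
  N%:R * \sum_(g in copies G (induce (complete k n) U)) F g.
Proof.
move=> hN; rewrite (partition_big (fun a => induce a U)
  (mem (copies G (induce (complete k n) U)))) /=; last first.
  move=> a; rewrite inE mem_copies_induce_complete => /andP[_ ->].
  by rewrite subsetIr.
rewrite mulr_sumr; apply: eq_bigr => g gG; rewrite -(hN g gG).
rewrite (eq_bigr (fun=> F g)); last by move=> a /andP[_ /eqP ->].
rewrite sumr_const mulr_natl; congr (_ *+ _); apply: eq_card => a.
rewrite unfold_in /= !in_set; case: eqP => [->|_]; rewrite ?andbF ?andbT //.
by move: gG; rewrite mem_copies_induce_complete => /andP[_ ->]; rewrite andbT.
Qed.

(** * Embeddings and the proportion of extending copies *)

Definition embs (a : kgraph k 'I_n) : {set {ffun T -> 'I_n}} :=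
  [set f : {ffun T -> 'I_n} | [&& dinjectiveb f (vset H), f @: vset H == vset a &
        [set f @: (e : {set T}) | e in eset H] == eset a]].

Lemma embsP (f : {ffun T -> 'I_n}) a :
  reflect (exists fi : {in vset H &, injective f}, gimage fi = a) (f \in embs a).
Proof.
rewrite inE; apply: (iffP and3P) => [[/dinjectiveP fi /eqP eV /eqP eE]|[fi <-]].
  by exists fi; apply: kgraph_inj.
by split; rewrite ?eqxx //; apply/dinjectiveP.
Qed.

(** Compose with a permutation taking one copy to the other. Counting copies thus amounts to
    counting embeddings, up to one common factor. *)
Lemma card_embs a b : isomorphic H a -> isomorphic H b -> #|embs a| = #|embs b|.
Proof.
suff le x y : isomorphic H x -> isomorphic H y -> (#|embs x| <= #|embs y|)%N.
  by move=> ha hb; apply/eqP; rewrite eqn_leq !le.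
move=> hx hy; have [s _ <-] := gperm_trans hx hy (subsetT _) (subsetT _).
pose h (f : {ffun T -> 'I_n}) := [ffun z => s (f z)].
have hi : injective h.
  by move=> f g /ffunP fg; apply/ffunP => z; have := fg z; rewrite !ffunE => /perm_inj.
rewrite -(card_imset _ hi) subset_leq_card //; apply/subsetP => _ /imsetP[f + ->].
move=> /embsP[fi <-].
have si : {in vset H &, injective (h f)}.
  by move=> x' y' xG yG; rewrite !ffunE => /perm_inj; apply: fi.
apply/embsP; exists si; apply/esym/gperm_gimage => z _; rewrite ffunE //.
Qed.

Lemma sum_card_embs (A : {set kgraph k 'I_n}) :
  (\sum_(a in A) #|embs a| = \sum_(f : {ffun T -> 'I_n}) #|[set a in A | f \in embs a]|)%N.
Proof.
under eq_bigr do rewrite -sum1_card.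
rewrite (exchange_big_dep predT) //=; apply: eq_bigr => f _.
by rewrite sum1_card; apply: eq_card => a; rewrite [RHS]in_set unfold_in.
Qed.

(** A map determines its image graph, so it is counted for at most one copy. Its values outside
    [vset H] are free, whence the exponent [#|T|] rather than [vnum H]. *)
Lemma sum_card_embs_le (A : {set kgraph k 'I_n}) :
  (\sum_(a in A) #|embs a| <= n ^ #|T|)%N.
Proof.
rewrite sum_card_embs.
have -> : (n ^ #|T| = \sum_(f : {ffun T -> 'I_n}) 1)%N.
  by rewrite sum1_card card_ffun card_ord.
apply: leq_sum => f _; apply/card_le1_eqP => a b.
by rewrite !in_set => /andP[_ /and3P[_ /eqP v1 /eqP e1]] /andP[_ /and3P[_ /eqP v2 /eqP e2]];
   apply: kgraph_inj; [rewrite -v1|rewrite -e1].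
Qed.

Definition split_maps : {set {ffun T -> 'I_n}} :=
  [set f in family (fun x => if x \in vset G then U else
                             if x \in vset H then ~: U else setT)].

Definition split_embs : {set {ffun T -> 'I_n}} :=
  [set f in split_maps | dinjectiveb f (vset H)].

(** Such an [f] sends exactly the vertices of [G] among those of [H] into [U]. As [G] is induced in
    [H], the image of [H] restricted to [U] is the image of [G], without further edges. *)
Lemma split_embs_le : subgraph G H -> induced_in H G ->
  (#|split_embs| <= \sum_(a in ext_copies) #|embs a|)%N.
Proof.
move=> /andP[GH GHe] /forall_inP ind; rewrite sum_card_embs -sum1_card big_mkcond.
apply: leq_sum => f _; case: ifP => //; rewrite !inE => /andP[/familyP fam /dinjectiveP fi].
rewrite card_gt0; apply/set0Pn; exists (gimage fi).
rewrite inE; apply/andP; split; last by apply/embsP; exists fi.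
rewrite inE mem_copies_complete; apply/andP; split; first by apply/isomorphicP; exists f, fi.
have fU x : x \in vset H -> (f x \in U) = (x \in vset G).
  by move=> xH; have := fam x; rewrite xH; case: (x \in vset G) => //; rewrite inE => /negPf.
have fGi : {in vset G &, injective f}.
  by move=> x y xG yG; apply: fi; apply: (subsetP GH).
apply/isomorphicP; exists f, fGi; apply: kgraph_inj; rewrite /vset /eset /=; apply/setP => y.
  rewrite inE; apply/imsetP/andP => [[x xG ->]|[/imsetP[x xH ->]]].
    by have xH := subsetP GH x xG; rewrite imset_f // fU.
  by rewrite fU // => xG; exists x.
rewrite inE; apply/imsetP/andP => [[e eG ->]|[/imsetP[e eH ->] eU]].
  split; first by rewrite imset_f // (subsetP GHe).
  apply/subsetP => _ /imsetP[x xe ->].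
  by have xG := subsetP (edge_sub eG) x xe; rewrite fU // (subsetP GH).
exists e => //; apply: (implyP (ind e eH)); apply/subsetP => x xe.
by rewrite -fU ?(subsetP (edge_sub eH)) // (subsetP eU) ?imset_f.
Qed.

Lemma card_split_maps : subgraph G H ->
  #|split_maps| = (#|U| ^ vnum G * #|~: U| ^ (vnum H - vnum G) * n ^ (#|T| - vnum H))%N.
Proof.
move=> /andP[GH _]; rewrite /split_maps cardsE card_family.
have prodE (F : T -> nat) : foldr muln 1%N [seq F x | x : T] = (\prod_x F x)%N.
  by rewrite -big_enum /image_mem; elim: (enum T) => [|x s IH]; rewrite ?big_nil // big_cons /= IH.
rewrite prodE (bigID (mem (vset H))) /= (bigID (mem (vset G))) /=; congr (_ * _ * _)%N.
- rewrite (eq_bigr (fun=> #|U|)); last by move=> x /andP[_ ->].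
  rewrite prod_nat_const; congr (_ ^ _)%N; apply: eq_card => x.
  by rewrite -topredE /= andb_idl //; apply: (subsetP GH).
- rewrite (eq_bigr (fun=> #|~: U|)); last by move=> x /andP[-> /negPf ->].
  rewrite prod_nat_const; congr (_ ^ _)%N; rewrite /vnum -(cardsDS GH); apply: eq_card => x.
  by rewrite inE -topredE /= andbC.
- rewrite (eq_bigr (fun=> n)).
    rewrite prod_nat_const; congr (_ ^ _)%N; rewrite /vnum -(cardC (vset H)) addKn.
    by apply: eq_card => x; rewrite -topredE.
  move=> x xH; rewrite (negPf xH); have /negPf -> : x \notin vset G.
    by apply: contra xH; apply: (subsetP GH).
  by rewrite cardsT card_ord.
Qed.

(** Overwriting [f x] by an arbitrary value is injective on pairs of map and value, since the old
    [f x] can be read off from [f y]. *)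
Lemma card_eq_val (x y : T) : x != y ->
  (#|[set f : {ffun T -> 'I_n} | f x == f y]| * n <= n ^ #|T|)%N.
Proof.
move=> xy; pose h (u : {ffun T -> 'I_n} * 'I_n) := [ffun z => if z == x then u.2 else u.1 z].
pose A := setX [set f : {ffun T -> 'I_n} | f x == f y] [set: 'I_n].
have cA : #|A| = (#|[set f : {ffun T -> 'I_n} | f x == f y]| * n)%N.
  by rewrite cardsX cardsT card_ord.
have hi : {in A &, injective h}.
  move=> [f c] [g d]; rewrite !inE /= !andbT => /eqP fxy /eqP gxy /ffunP e.
  have ez z : z != x -> f z = g z by move=> zx; have := e z; rewrite !ffunE (negPf zx).
  have := e x; rewrite !ffunE eqxx /= => ->; congr (_, _); apply/ffunP => z.
  have [->|zx] := eqVneq z x; last exact: ez.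
  by rewrite fxy gxy ez // eq_sym.
rewrite -cA -(card_in_imset hi); apply: leq_trans (max_card _) _.
by rewrite card_ffun card_ord.
Qed.

(** A map that is not injective on [vset H] identifies one of at most [vnum H ^ 2] ordered pairs,
    and each pair accounts for a share of at most [1 / n] of all maps. *)
Lemma split_maps_le :
  (#|split_maps| * n <= #|split_embs| * n + vnum H ^ 2 * n ^ #|T|)%N.
Proof.
pose B (u : T * T) := [set f : {ffun T -> 'I_n} | f u.1 == f u.2].
pose Q := [set u : T * T | [&& u.1 \in vset H, u.2 \in vset H & u.1 != u.2]].
have sub : split_maps \subset split_embs :|: \bigcup_(u in Q) B u.
  apply/subsetP => f fs; rewrite inE.
  case: (boolP (dinjectiveb f (vset H))) => fi; first by rewrite inE fs fi.
  apply/orP; right; move/dinjectivePn: fi => [x xH [y]].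
  rewrite inE => /andP[yx yH] fxy; apply/bigcupP; exists (x, y).
    by rewrite !inE /= xH yH eq_sym.
  by rewrite inE fxy.
have le1 : (#|\bigcup_(u in Q) B u| * n <= vnum H ^ 2 * n ^ #|T|)%N.
  apply: (@leq_trans (\sum_(u in Q) #|B u| * n)%N).
    rewrite -big_distrl leq_mul2r /=; apply/orP; right.
    elim/big_rec2: _ => [|u m A _ hA]; first by rewrite cards0.
    by apply: leq_trans (leq_card_setU _ _) _; rewrite leq_add2l.
  apply: (@leq_trans (\sum_(u in Q) n ^ #|T|)%N).
    by apply: leq_sum => u; rewrite inE => /and3P[_ _]; apply: card_eq_val.
  rewrite sum_nat_const leq_mul2r; apply/orP; right.
  rewrite expnS expn1 -cardsX subset_leq_card //.
  by apply/subsetP => u; rewrite !inE => /and3P[-> ->].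
apply: leq_trans (_ : #|split_embs :|: \bigcup_(u in Q) B u| * n <= _)%N.
  by rewrite leq_mul2r subset_leq_card ?orbT.
apply: leq_trans (_ : (#|split_embs| + #|\bigcup_(u in Q) B u|) * n <= _)%N.
  by rewrite leq_mul2r leq_card_setU orbT.
by rewrite mulnDl leq_add2l.
Qed.

End Fibers.

(** Bernoulli's inequality for [(1 - c / n) ^+ v], multiplied by [n ^+ v.+1] to avoid division. *)
Lemma bernoulli_sub (R : realFieldType) (n c : R) v : 0 <= c <= n ->
  n ^+ v * (n - v%:R * c) <= n * (n - c) ^+ v.
Proof.
move=> /andP[c0 cn]; have n0 := le_trans c0 cn.
elim: v => [|v IH]; first by rewrite !expr0 mul0r subr0 mulr1 mul1r.
have nc : 0 <= n - c by rewrite subr_ge0.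
rewrite [(n - c) ^+ _]exprS mulrCA.
apply: le_trans (ler_wpM2l nc IH).
rewrite exprS -natr1 -subr_ge0.
have -> : (n - c) * (n ^+ v * (n - v%:R * c)) - n * n ^+ v * (n - (v%:R + 1) * c) =
   v%:R * n ^+ v * c ^+ 2 by ring.
by rewrite !mulr_ge0 ?ler0n ?exprn_ge0 ?sqr_ge0.
Qed.

(** All copies have the same number [M] of embeddings, so both counts are compared through vertex
    maps. There are at most [n ^ #|T|] embeddings in all, and a share of about [2 ^- vnum H] of all
    maps splits along [U]; the lower bound on [n] keeps the further losses within a factor 2. *)
Lemma card_copies_le_ext (R : realType) (l : R) k n (T : finType) (G H : kgraph k T)
    (U : {set 'I_n}) :
  0 <= l -> subgraph G H -> induced_in H G ->
  4 * l * (vnum H)%:R + 2 ^+ (vnum H).+1 * (vnum H)%:R ^+ 2 + 2 * l + 1 <= n%:R ->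
  `| #|U|%:R - n%:R / 2 | <= l ->
  #|copies H (complete k n)|%:R <= 2 ^+ (vnum H).+1 * #|ext_copies G H U|%:R :> R.
Proof.
move=> l0 GH ind nl Ul.
have [->|[a0 a0H]] := set_0Vmem (copies H (complete k n)).
  by rewrite cards0 mulr_ge0 ?exprn_ge0 ?ler0n.
rewrite mem_copies_complete in a0H.
pose M := #|embs H a0|.
have M0 : (0 < M)%N.
  by rewrite card_gt0; apply/set0Pn; case/isomorphicP: a0H => f h; exists f; apply/embsP.
have cM (A : {set kgraph k 'I_n}) : A \subset copies H (complete k n) ->
    (\sum_(a in A) #|embs H a| = #|A| * M)%N.
  move=> /subsetP AH; rewrite -sum_nat_const; apply: eq_bigr => a aA.
  by apply: card_embs => //; rewrite -mem_copies_complete AH.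
have h1 := sum_card_embs_le H (copies H (complete k n)); rewrite cM // in h1.
have h2 := split_embs_le U GH ind; rewrite cM in h2; last first.
  by apply/subsetP => a; rewrite inE => /andP[].
have h3 := split_maps_le G H U; rewrite card_split_maps // in h3.
set v := vnum H in nl h3 *.
have av : (vnum G <= v)%N by apply: subset_leq_card; case/andP: GH.
have vt : (v <= #|T|)%N by apply: max_card.
have UC : #|~: U|%:R = n%:R - #|U|%:R :> R.
  by apply/eqP; rewrite eq_sym subr_eq -natrD addnC cardsC card_ord.
have v0 : (0 : R) <= v%:R by rewrite ler0n.
have lv : 0 <= l * v%:R by rewrite mulr_ge0.
have pv : (0 : R) <= 2 ^+ v.+1 * v%:R ^+ 2 by rewrite mulr_ge0 ?exprn_ge0.
have [x0 xn n0 nK] : [/\ 0 <= 2 * l, 2 * l <= n%:R, (0 : R) < n%:R &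
    4 * (l * v%:R) + 2 ^+ v.+1 * v%:R ^+ 2 <= n%:R].
  move: nl pv l0 lv; rewrite -mulrA; move: (2 ^+ _ * _) (l * _) (n%:R) => K lv nr.
  by clear; move=> *; split; lra.
clear nl pv; move: Ul; rewrite ler_distl => /andP[u1 u2].
pose x : R := n%:R / 2 - l.
have [xx xU xUC xE] : [/\ 0 <= x, x <= #|U|%:R, x <= #|~: U|%:R & 2 * x = n%:R - 2 * l].
  rewrite UC /x; move: u1 u2 xn x0; move: (#|U|%:R) (n%:R) => u nr; clear.
  by move=> *; split; lra.
have e1 : x ^+ v <= #|U|%:R ^+ vnum G * #|~: U|%:R ^+ (v - vnum G).
  rewrite -{1}(subnKC av) exprD; apply: ler_pM; rewrite ?exprn_ge0 //.
    by apply: lerXn2r; rewrite ?nnegrE.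
  by apply: lerXn2r; rewrite ?nnegrE ?ler0n.
have e2 : n%:R ^+ v * (n%:R - v%:R * (2 * l)) <= n%:R * (2 ^+ v * x ^+ v) :> R.
  rewrite -exprMn xE.
  by apply: bernoulli_sub; rewrite x0 xn.
(* The relative losses [2 l v / n], from the size of [U], and [2 ^ v v ^ 2 / n], from non-injective
   maps, add up to at most 1/2. *)
have e3 : n%:R ^+ #|T| <= 2 ^+ v.+1 * #|split_embs G H U|%:R :> R.
  have := h3; rewrite -(ler_nat R) natrD !natrM !natrX.
  set g : R := #|split_embs G H U|%:R; set y : R := n%:R ^+ (#|T| - v).
  have y0 : 0 <= y by rewrite exprn_ge0 ?ler0n.
  have yE : n%:R ^+ #|T| = n%:R ^+ v * y :> R by rewrite -exprD subnKC.
  set w := _ ^+ _ * _ ^+ _ in e1 *.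
  move=> h4; rewrite -(ler_pM2r n0).
  have h5 : 2 ^+ v * (w * y * n%:R) <= 2 ^+ v * (g * n%:R + v%:R ^+ 2 * n%:R ^+ #|T|).
    by rewrite ler_wpM2l ?exprn_ge0.
  have h6 : n%:R * (2 ^+ v * x ^+ v) * y <= n%:R * (2 ^+ v * w) * y.
    by rewrite ler_wpM2r // ler_wpM2l ?ler0n // ler_wpM2l ?exprn_ge0.
  have h7 := ler_wpM2r y0 e2.
  have h8 : n%:R ^+ #|T| * (4 * (l * v%:R) + 2 ^+ v.+1 * v%:R ^+ 2) <= n%:R ^+ #|T| * n%:R :> R.
    by rewrite ler_wpM2l ?exprn_ge0 ?ler0n.
  move: h5 h8; rewrite [2 ^+ v.+1]exprS yE => h5 h8.
  move: h5 h6 h7 h8; clear h4 y0 yE e1.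
  move: (n%:R) (v%:R) (2 ^+ v) (n%:R ^+ v) (x ^+ v) w y g => nr vr t N X w y g.
  by clear=> *; lra.
have Mr : (0 : R) < M%:R by rewrite ltr0n.
rewrite -(ler_pM2r Mr) -mulrA -!natrM.
apply: (@le_trans _ _ (n%:R ^+ #|T|)); first by rewrite -natrX ler_nat.
by apply: le_trans e3 _; rewrite ler_wpM2l ?exprn_ge0 // ler_nat.
Qed.

(** * Comparison with [Lambda], conditional means and conclusion *)

Lemma le_Lambda (R : realType) k (T : finType) (H : kgraph k T) n (p : R) :
  0 <= p <= 1 ->
  \sum_(u : kgraph k 'I_n * kgraph k 'I_n |
        [&& u.1 \in copies H (complete k n), u.2 \in copies H (complete k n) &
            eset u.1 :&: eset u.2 != set0])
    rexp (@edge_prob R k n p) (fun S => (eset u.1 \subset S)%:R * (eset u.2 \subset S)%:R)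
  <= Lambda H n p.
Proof.
move=> p01; have q01 e := @edge_prob01 R k n p e p01.
rewrite /Lambda gnp_expE (eq_rexp _ (@X_edge_graph R k T H n)) rexp_sum.
(* A diagonal pair contributes the mean of its indicator, or nothing if the copy has no edges, so
   the diagonal is at most [E X_H]; the rest is the pair sum of [Lambda]. *)
rewrite (bigID (fun u => u.1 == u.2)) /=; apply: lerD.
  rewrite big_mkcond [X in _ <= X]big_mkcond /=.
  pose F (a b : kgraph k 'I_n) : R :=
    if [&& a \in copies H (complete k n), b \in copies H (complete k n) &
           eset a :&: eset b != set0] && (a == b)
    then rexp (@edge_prob R k n p) (fun S => (eset a \subset S)%:R * (eset b \subset S)%:R)
    else 0.
  rewrite -[X in X <= _](pair_bigA _ F) /=; apply: ler_sum => a _.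
  rewrite (bigD1 a) //= big1 ?addr0; last first.
    by move=> b ba; rewrite /F [a == b]eq_sym (negPf ba) andbF.
  rewrite /F /= eqxx andbT; case: (a \in _) => //=.
  have E0 : 0 <= rexp (edge_prob k p) (fun S : {set {set 'I_n}} => (eset a \subset S)%:R).
    by apply: rexp_ge0 => // S; rewrite ler0n.
  case: ifP => // _; rewrite le_eqVlt; apply/orP; left; apply/eqP.
  by apply: eq_rexp => S; rewrite -natrM mulnb andbb.
rewrite le_eqVlt; apply/orP; left; apply/eqP.
apply: eq_big => [u|u _]; first by rewrite -!andbA; do !bool_congr; rewrite andbC.
by rewrite gnp_expE; apply: eq_rexp => S; rewrite /copy_ind !sub_eset_edge_graph.
Qed.

(** Given the edges inside [U], an extending copy needs its restriction to be present and its other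
    [edgenum H - edgenum G] edges to appear, each with probability [p]. Grouping by restriction
    yields the factor [N]. *)
Lemma cexp_ext_copies (R : realType) k (T : finType) (G H : kgraph k T) n (U : {set 'I_n})
    (p : R) N :
  (forall g, g \in copies G (induce (complete k n) U) ->
    #|[set a in copies H (complete k n) | induce a U == g]| = N) ->
  forall S : {set {set 'I_n}},
  cexp (@edge_prob R k n p) [set e : {set 'I_n} | e \subset U]
    (fun S => \sum_(a in ext_copies G H U) (eset a \subset S)%:R) S =
  N%:R * p ^+ (edgenum H - edgenum G) * Y_ R G U (edge_graph k S).
Proof.
move=> hN S; rewrite /cexp rexp_sum Y_edge_graph.
pose F (g : kgraph k 'I_n) : R := p ^+ (edgenum H - edgenum G) * (eset g \subset S)%:R.
rewrite -mulrA mulr_sumr -(sum_ext_copies F hN); apply: eq_bigr => a.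
rewrite inE mem_copies_complete => /andP[aH aG].
rewrite -/(cexp _ _ (fun S => (eset a \subset S)%:R) S) cexp_sub mulrC.
have -> : eset a :&: [set e : {set 'I_n} | e \subset U] = eset (induce a U).
  by apply/setP => e; rewrite !inE.
congr (_ * _).
rewrite (eq_bigr (fun=> p)); last first.
  by move=> e; rewrite inE => /andP[_ ea]; rewrite /edge_prob (card_edge ea) eqxx.
rewrite prodr_const; congr (_ ^+ _); rewrite cardsD -(edgenum_iso aH) -(edgenum_iso aG).
by congr (_ - #|pred_of_set _|)%N; apply/setP => e; rewrite !inE.
Qed.

Theorem theorem20 (R : realType) (k : nat) (hk : (2 <= k)%N)
    (T : finType) (H : kgraph k T) (l : R) (hl : 0 <= l) :
  exists n0 : nat,
  forall G : kgraph k T,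
    subgraph G H ->
    (1 <= edgenum G)%N ->
    (forall a : kgraph k T, a \in copies G H -> induced_in H a) ->
  forall n : nat, (n0 <= n)%N ->
  forall U : {set 'I_n}, `| #|U|%:R - n%:R / 2 | <= l ->
  forall p eps : R,
    0 <= p <= 1 -> 0 < eps <= 1 ->
    (eps * gnp_exp p (X_ R H n)) ^+ 2 >= Lambda H n p ->
  let lambda : R := 2 ^+ (vnum H + 3)%N in
  let c : R := 2 ^- (4 ^ (vnum G ^ 2) + 2)%N in
  gnp_pr p (fun F => X_ R H n F <= (1 - eps) * gnp_exp p (X_ R H n)) >=
  c * gnp_pr p
        (fun F => Y_ R G U F <= (1 - lambda * eps) * gnp_exp p (Y_ R G U)).
Proof.
(* The threshold of [card_copies_le_ext]; it involves only [vnum H] and [l], so one [n0] serves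
   every [G]. *)
pose B : R := 4 * l * (vnum H)%:R + 2 ^+ (vnum H).+1 * (vnum H)%:R ^+ 2 + 2 * l + 1.
have B0 : 0 <= B by rewrite /B !addr_ge0 ?mulr_ge0 ?exprn_ge0 ?ler0n.
exists (Num.bound B) => G GH _ ind n hn U Ul p eps p01 /andP[eps0 _] hLam.
cbv zeta; set lambda : R := 2 ^+ (vnum H + 3); set c : R := 2 ^- _.
have Bn : B <= n%:R.
  by apply: le_trans (ltW (archi_boundP B0)) _; rewrite ler_nat.
have indG : induced_in H G by apply: ind; rewrite inE GH isomorphic_refl.
have many := card_copies_le_ext hl GH indG Bn Ul.
have q01 e := @edge_prob01 R k n p e p01.
set mu := gnp_exp p (X_ R H n) in hLam *; set nu := gnp_exp p (Y_ R G U).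
rewrite !gnp_prE.
pose P := copies H (complete k n); pose Z := ext_copies G H U.
pose a S := Y_ R G U (edge_graph k S) <= (1 - lambda * eps) * nu.
pose X (Q : {set kgraph k 'I_n}) (S : {set {set 'I_n}}) : R := \sum_(j in Q) (eset j \subset S)%:R.
have muE : mu = rexp (@edge_prob R k n p) (X P).
  by rewrite /mu gnp_expE; apply: eq_rexp => S; rewrite X_edge_graph.
have X0 Q S : 0 <= X Q S by apply: sumr_ge0 => j _; rewrite ler0n.
have mu0 : 0 <= mu by rewrite muE rexp_ge0.
(* The exponent in [c] is at least 2, and 1/4 lies below the 5/9 of the bootstrap. *)
have c14 : c <= 1 / 4.
  rewrite /c exprD invfM (_ : 2 ^- 2 = 1 / 4 :> R); last by field.
  rewrite ler_piMl ?divr_ge0 //.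
  by rewrite invf_le1 ?exprn_ege1 ?exprn_gt0 // ler1n.
have a0 : 0 <= rexp (@edge_prob R k n p) (fun S => (a S)%:R).
  by apply: rexp_ge0 => // S; rewrite ler0n.
(* The bootstrap needs [0 < eps * mu], so mean zero is treated apart: as [X_H] is a natural number,
   [1 - X_H] is at most the indicator of [X_H <= 0], and its mean is 1. *)
have [mu_eq0|mu_neq0] := eqVneq mu 0.
  apply: (@le_trans _ _ (rexp (@edge_prob R k n p) (fun S => 1 - X P S))).
    rewrite rexpB rexpC -muE mu_eq0 subr0.
    have a1 : rexp (@edge_prob R k n p) (fun S => (a S)%:R) <= 1.
      rewrite -[X in _ <= X](rexpC (@edge_prob R k n p)); apply: ler_rexp => // S.
      by rewrite lern1 leq_b1.
    apply: le_trans (ler_wpM2r a0 c14) _.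
    by move: a1 a0; move: (rexp _ _) => x; clear; lra.
  apply: ler_rexp => // S; rewrite /X /P -X_edge_graph mu_eq0 mulr0 /X_.
  case: (ncopies _ _) => [|m]; rewrite ?lexx ?subr0 //.
  by rewrite -natr1 opprD addrCA subrr addr0 (le_trans _ (ler0n _ _)) // oppr_le0.
have mupos : 0 < mu by rewrite lt_neqAle eq_sym mu_neq0.
pose D := [set e : {set 'I_n} | e \subset U].
have [N hN] := ext_fiber_const G H U.
(* Copies of [G] inside [U] have all their edges in [D], so resampling outside [D] does not affect
   them. *)
have YE S S' : Y_ R G U (edge_graph k (mix D S S')) = Y_ R G U (edge_graph k S).
  rewrite !Y_edge_graph; apply: eq_bigr => g.
  rewrite mem_copies_induce_complete => /andP[gU _]; rewrite sub_mix.
  have gD : eset g \subset D.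
    by apply/subsetP => e eg; rewrite inE (subset_trans (edge_sub eg)).
  by rewrite (setIidPl gD) (_ : _ :\: D = set0) ?sub0set ?andbT //; apply/eqP; rewrite setD_eq0.
have EZ : rexp (@edge_prob R k n p) (X Z) = N%:R * p ^+ (edgenum H - edgenum G) * nu.
  by rewrite -(rexp_cexp _ D) (eq_rexp _ (cexp_ext_copies p hN)) rexpZ /nu gnp_expE.
have EX (Q : {set kgraph k 'I_n}) : Q \subset P ->
    rexp (@edge_prob R k n p) (X Q) = #|Q|%:R * p ^+ edgenum H.
  move=> /subsetP QP; rewrite rexp_sum mulr_natl -sumr_const; apply: eq_bigr => j /QP jP.
  rewrite rexp_sub (eq_bigr (fun=> p)); last first.
    by move=> e ea; rewrite /edge_prob (card_edge ea) eqxx.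
  rewrite prodr_const; congr (_ ^+ _).
  by rewrite -/(edgenum j); apply: edgenum_iso; rewrite -mem_copies_complete.
have ZP : Z \subset P by apply/subsetP => j; rewrite inE => /andP[].
(* All copies of [H] have the same probability, so the ratio of counts carries over to means. In
   [lambda = 4 * 2 ^+ (vnum H).+1] the first factor serves the gap [4 * d] and the second comes from
   [card_copies_le_ext]. *)
have EZmu : 4 * mu <= lambda * rexp (@edge_prob R k n p) (X Z).
  rewrite muE !EX // /lambda addnC exprD.
  have pe : 0 <= p ^+ edgenum H by rewrite exprn_ge0 //; case/andP: p01.
  have := ler_wpM2r pe many; rewrite [2 ^+ (vnum H).+1]exprS -/P -/Z.
  move: (2 ^+ vnum H) (p ^+ _) (#|P|%:R) (#|Z|%:R) => t r x z; clear; lra.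
have := @lower_tail_bootstrap R _ _ q01 _ P Z (@eset k _) D a (eps * mu).
move=> /(_ ZP (mulr_gt0 eps0 mupos)) boot.
have : 5 / 9 * rexp (edge_prob k p) (fun S : {set {set 'I_n}} => (a S)%:R) <=
   rexp (edge_prob k p) (fun S => (X P S <= rexp (edge_prob k p) (X P) - eps * mu)%R%:R).
  apply: boot.
  - move=> S S' SS'; rewrite /a; apply: le_trans; rewrite !Y_edge_graph.
    apply: ler_sum => g _; rewrite ler_nat.
    by case: (boolP (eset g \subset S)) => // h; rewrite (subset_trans h).
  - by move=> S S'; rewrite /a YE.
  (* On [a] the conditional mean, a multiple of [Y_G], is at most [1 - lambda * eps] times the mean
     of [X Z]; by [EZmu] the loss is at least [4 * (eps * mu)]. *)
  - move=> S aS; rewrite -/(X Z) EZ (cexp_ext_copies p hN).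
    apply: (@le_trans _ _ (N%:R * p ^+ (edgenum H - edgenum G) * ((1 - lambda * eps) * nu))).
      by rewrite ler_wpM2l // mulr_ge0 ?ler0n // exprn_ge0 //; case/andP: p01.
    have := ler_wpM2r (ltW eps0) EZmu; rewrite EZ.
    by move: (lambda) (mu) (nu) (_ * p ^+ _) => x y z r; clear; lra.
  - by apply: le_trans hLam; apply: le_Lambda.
move=> h; apply: le_trans (_ : 5 / 9 * _ <= _).
  by apply: ler_wpM2r a0 _ _ _; apply: le_trans c14 _; clear; lra.
apply: le_trans h _; rewrite le_eqVlt; apply/orP; left; apply/eqP.
by apply: eq_rexp => S; rewrite X_edge_graph -muE mulrBl mul1r.
Qed.
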